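(* Consider the monadic predicate language with infinitely many individual variables over the vocabulary $\tau=\{P\}$, where $P$ is a unary predicate, with primitives $[\neg,\rightarrow,\exists]$ and with $\forall x\,\phi$ abbreviating $\neg\exists x\neg\phi$. Let $\mathfrak{A}$ be the two-element structure with domain $A=\{u,v\}$ ($u\neq v$), with distinguished element $u$, and with $\mathfrak{A}(P(x_i))=\{v\}$ for every variable $x_i$; let $\models^*$ and ''true$^*$ in $\mathfrak{A}$'' be as defined in the context. Then every instance of each of the axiom schemata (A1)–(A5) listed in the context is true$^*$ in $\mathfrak{A}$, and the rules (R1) and (R2) preserve the property of being true$^*$ in $\mathfrak{A}$, whereas the formula $$\exists x P(x)\rightarrow\exists x\neg\neg P(x)$$ is not true$^*$ in $\mathfrak{A}$.
   Context: **Language.** There are infinitely many individual variables $x_1,x_2,x_3,\dots$ and a single unary predicate letter $P$. Formulas are built from atomic formulas $P(x_i)$ using $\neg\phi$, $\phi\rightarrow\psi$ and $\exists x_j\,\phi$ (no equality). The expression $\forall x_j\,\phi$ is an abbreviation for $\neg\exists x_j\neg\phi$. **Axiomatization.** The axiom schemata are as follows, where $\phi,\psi,\chi$ are arbitrary formulas and $x$ is a place holder for any of the variables $x_1,x_2,\dots$: (A1) $\phi\rightarrow(\psi\rightarrow\phi)$; (A2) $(\phi\rightarrow(\psi\rightarrow\chi))\rightarrow((\phi\rightarrow\psi)\rightarrow(\phi\rightarrow\chi))$; (A3) $(\neg\phi\rightarrow\neg\psi)\rightarrow(\psi\rightarrow\phi)$; (A4) $\forall x\,\phi(x)\rightarrow\phi(x)$;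 (A5) $\forall x(\phi\rightarrow\psi(x))\rightarrow(\phi\rightarrow\forall x\,\psi(x))$, where $x$ is not free in $\phi$. The rules are: (R1) Modus Ponens: from $\phi\rightarrow\psi$ and $\phi$ infer $\psi$; (R2) Generalization: from $\phi$ infer $\forall x\,\phi$. **Nonstandard satisfaction $\models^*$.** Satisfaction is defined for a formula $\phi$ together with a finite (possibly empty) list of distinct variables $x_{i_1},\dots,x_{i_n}$ containing all free variables of $\phi$, and a sequence $a_{i_1},\dots,a_{i_n}$ of elements of $A$ (repetitions allowed), where $a_{i_l}$ is the value of $x_{i_l}$: - $\mathfrak{A}\models^* P(x_{i_k})[a_{i_1},\dots,a_{i_n}]$ iff $a_{i_k}\in\mathfrak{A}(P(x_{i_k}))$, i.e. iff $a_{i_k}=v$; - $\mathfrak{A}\models^*\neg\psi[a_{i_1},\dots,a_{i_n}]$ iff $a_{i_l}=u$ for all $1\le l\le n$ and $\mathfrak{A}\not\models^*\psi[u,\dots,u]$ ($n$ entries $u$); - $\mathfrak{A}\models^*(\psi\rightarrow\chi)[a_{i_1},\dots,a_{i_n}]$ iff $\mathfrak{A}\not\models^*\psi[a_{i_1},\dots,a_{i_n}]$ or $\mathfrak{A}\models^*\chi[a_{i_1},\dots,a_{i_n}]$; - $\mathfrak{A}\models^*\exists x_j\psi[a_{i_1},\dots,a_{i_n}]$ iff $\mathfrak{A}\models^*\psi[a_{i_1},\dots,a_{i_n},b]$ for some $b\in A$, where $b$ is the value of $x_j$ and $\psi$ is taken with the list $x_{i_1},\dots,x_{i_n},x_j$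 (if $x_j$ already occurs in the list $x_{i_1},\dots,x_{i_n}$, the list is kept and the value of $x_j$ is replaced by $b$). Since $\forall x_j\psi$ is $\neg\exists x_j\neg\psi$, its clause amounts to: $\mathfrak{A}\models^*\forall x_j\psi[a_{i_1},\dots,a_{i_n}]$ iff $a_{i_l}=u$ for all $1\le l\le n$ and $\psi$ is satisfied when all listed variables, including $x_j$, have value $u$. **Truth$^*$.** A formula $\phi$ with free variables $x_{i_1},\dots,x_{i_n}$ is true$^*$ in $\mathfrak{A}$ if $\mathfrak{A}\models^*\phi[u,\dots,u]$ ($n$ entries $u$, relative to the list of its free variables). *)

(* Defs.v *)
From mathcomp Require Import all_boot.
Set Implicit Arguments.
Unset Strict Implicit.
Unset Printing Implicit Defensive.

(* The index [i] stands for the variable x_(i+1). *)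
Definition var := nat.

Inductive formula : Type :=
| Atom of var                (* P(x) *)
| Neg of formula
| Imp of formula & formula
| Ex of var & formula.

Definition All (x : var) (phi : formula) : formula := Neg (Ex x (Neg phi)).

(* The duplicate-free list of the free variables of a formula. *)
Fixpoint fv (phi : formula) : seq var :=
  match phi with
  | Atom x => [:: x]
  | Neg psi => fv psi
  | Imp psi chi => undup (fv psi ++ fv chi)
  | Ex x psi => [seq y <- fv psi | y != x]
  end.

(* In A4 the matrix is not substituted into: phi(x) is phi itself, with the
   same variable x as the quantifier, and x need not be free in phi. *)
Inductive axiom : formula -> Prop :=
| A1 phi psi : axiom (Imp phi (Imp psi phi))
| A2 phi psi chi :
    axiom (Imp (Imp phi (Imp psi chi)) (Imp (Imp phi psi) (Imp phi chi)))
| A3 phi psi : axiom (Imp (Imp (Neg phi) (Neg psi)) (Imp psi phi))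
| A4 x phi : axiom (Imp (All x phi) phi)
| A5 x phi psi : x \notin fv phi ->
    axiom (Imp (All x (Imp phi psi)) (Imp phi (All x psi))).

(* The domain of the structure; [u] is the distinguished element. *)
Inductive point : Type := u | v.

(* The interpretation of P(x), given separately for each variable x. *)
Definition interpP (x : var) : point -> Prop := fun a => a = v.

(* A list of variables [vs] together with a list of values [s] of the same
   length assigns the l-th value to the l-th variable. *)
Definition value (vs : seq var) (s : seq point) (x : var) : point :=
  nth u s (index x vs).

Definition ext_vars (vs : seq var) (x : var) : seq var :=
  if x \in vs then vs else rcons vs x.

Definition ext_vals (vs : seq var) (s : seq point) (x : var) (b : point) :
    seq point :=
  if x \in vs then set_nth u s (index x vs) b else rcons s b.

(* [sat phi vs s] is meaningful when [vs] is duplicate-free and contains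
   [fv phi], and [size s = size vs]; the recursive calls maintain this. *)
Fixpoint sat (phi : formula) (vs : seq var) (s : seq point) : Prop :=
  match phi with
  | Atom x => interpP x (value vs s x)
  | Neg psi =>
      (forall l, l < size vs -> nth u s l = u) /\
      ~ sat psi vs (nseq (size vs) u)
  | Imp psi chi => ~ sat psi vs s \/ sat chi vs s
  | Ex x psi => exists b : point, sat psi (ext_vars vs x) (ext_vals vs s x b)
  end.

Definition true_star (phi : formula) : Prop :=
  sat phi (fv phi) (nseq (size (fv phi)) u).

(* Main.v *)
Require Import Defs.
From mathcomp Require Import all_boot.
From Stdlib Require Import Classical.

(** Giving the value [u] to every unlisted variable turns satisfaction relative
    to a list into satisfaction [sem] under a total valuation: the clause for
    negation only asks that no variable has value [v].  Hence truth* is [sem] at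
    the constant valuation [u], where [Neg] is classical negation and [All x]
    does nothing, so the axioms become propositional tautologies.  The last
    formula fails because the witness [v] of [Ex x (Atom x)] satisfies no
    negation. *)

Definition update (e : var -> point) (x : var) (b : point) : var -> point :=
  fun y => if y == x then b else e y.

Fixpoint sem (phi : formula) (e : var -> point) : Prop :=
  match phi with
  | Atom x => interpP x (e x)
  | Neg psi => (forall x, e x = u) /\ ~ sem psi (fun=> u)
  | Imp psi chi => ~ sem psi e \/ sem chi e
  | Ex x psi => exists b, sem psi (update e x b)
  end.

(** Valuations read off from lists agree with [update] and with the constant [u] only pointwise;
    this stands in for functional extensionality. *)
Lemma sem_ext phi e e' : e =1 e' -> sem phi e <-> sem phi e'.
Proof.
elim: phi e e' => [x|psi _|psi IHpsi chi IHchi|x psi IH] e e' ee' /=.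
- by rewrite ee'.
- by split=> -[eu npsi]; split=> // x; rewrite -(eu x) ee'.
- by rewrite (IHpsi _ _ ee') (IHchi _ _ ee').
- have upd_ext b : update e x b =1 update e' x b.
    by move=> y; rewrite /update ee'.
  by split=> -[b psib]; exists b; apply/(IH _ _ (upd_ext b)).
Qed.

Lemma value_nseq vs : value vs (nseq (size vs) u) =1 fun=> u.
Proof. by move=> x; rewrite /value nth_nseq if_same. Qed.

Lemma ext_vars_uniq vs x : uniq vs -> uniq (ext_vars vs x).
Proof.
by rewrite /ext_vars; case: ifPn => // xNvs uvs; rewrite rcons_uniq xNvs.
Qed.

Lemma size_ext_vals vs s x b :
  size s = size vs -> size (ext_vals vs s x b) = size (ext_vars vs x).
Proof.
move=> ss; rewrite /ext_vals /ext_vars; case: ifP => xvs.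
  by rewrite size_set_nth ss; apply/maxn_idPr; rewrite index_mem.
by rewrite !size_rcons ss.
Qed.

Lemma value_ext vs s x b : size s = size vs ->
  value (ext_vars vs x) (ext_vals vs s x b) =1 update (value vs s) x b.
Proof.
move=> ss y; rewrite /value /ext_vars /ext_vals /update.
case: ifPn => xvs.
  rewrite nth_set_nth /=; case: (eqVneq y x) => [->|yx]; first by rewrite eqxx.
  case: eqP => // exy; case/eqP: yx.
  have yvs : y \in vs by rewrite -index_mem exy index_mem.
  by rewrite -(nth_index x yvs) exy nth_index.
rewrite -[rcons vs x]cats1 index_cat nth_rcons ss /=.
case: (boolP (y \in vs)) => yvs.
  rewrite index_mem yvs; case: eqVneq => // yx.
  by rewrite yx (negPf xvs) in yvs.
rewrite memNindex // (eq_sym y x); case: (x == y).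
  by rewrite addn0 ltnn eqxx.
(* Here [y] is neither listed nor equal to [x]: its index is past the end before and after the
   extension, so both sides are the default [u]. *)
by rewrite addn1 ltnNge leqnSn gtn_eqF //= nth_default ?ss.
Qed.

(** Unlisted variables have value [u] by default, and in a duplicate-free list each position is the
    index of its own variable. *)
Lemma value_all_u vs s : uniq vs -> size s = size vs ->
  (forall l, l < size vs -> nth u s l = u) <-> (forall x, value vs s x = u).
Proof.
move=> uvs ss; split=> su.
  move=> x; rewrite /value; have [/su //|?] := ltnP (index x vs) (size vs).
  by rewrite nth_default // ss.
by move=> l lvs; rewrite -{1}(index_uniq 0 lvs uvs); apply: su.
Qed.

Lemma sat_sem phi vs s : uniq vs -> size s = size vs ->
  sat phi vs s <-> sem phi (value vs s).
Proof.
elim: phi vs s => [x|psi IH|psi IHpsi chi IHchi|x psi IH] vs s uvs ss //=.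
- rewrite (value_all_u _ _ uvs ss) IH ?size_nseq //.
  by rewrite (sem_ext _ _ _ (value_nseq vs)).
- by rewrite IHpsi // IHchi.
- have satE b : sat psi (ext_vars vs x) (ext_vals vs s x b) <->
      sem psi (update (value vs s) x b).
    rewrite IH ?ext_vars_uniq ?size_ext_vals //.
    exact: sem_ext (value_ext _ _ _ _ ss).
  by split=> -[b /satE]; exists b.
Qed.

Lemma fv_uniq phi : uniq (fv phi).
Proof.
by elim: phi => //= *; [exact: undup_uniq | exact: filter_uniq].
Qed.

Lemma true_star_sem phi : true_star phi <-> sem phi (fun=> u).
Proof.
rewrite /true_star sat_sem ?fv_uniq ?size_nseq //.
exact: sem_ext (value_nseq _).
Qed.

Lemma sem_Imp phi psi e : sem (Imp phi psi) e <-> (sem phi e -> sem psi e).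
Proof. by split; [move=> /= [] | exact: imply_to_or]. Qed.

Lemma sem_Neg_u phi : sem (Neg phi) (fun=> u) <-> ~ sem phi (fun=> u).
Proof. by split=> [[]|]. Qed.

(** A witness for [Ex x (Neg phi)] must itself be [u], since a negation fails as soon as some
    variable has value [v]. *)
Lemma sem_All_u x phi : sem (All x phi) (fun=> u) <-> sem phi (fun=> u).
Proof.
rewrite /All sem_Neg_u /=; split=> [nEx|phiu [b []]] //.
apply: NNPP => nphi; apply: nEx; exists u; split=> // y.
by rewrite /update if_same.
Qed.

Theorem proposition4 :
  (forall phi : formula, axiom phi -> true_star phi) /\
  (forall phi psi : formula,
     true_star (Imp phi psi) -> true_star phi -> true_star psi) /\
  (forall (x : var) (phi : formula), true_star phi -> true_star (All x phi)) /\
  (forall x : var,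
     ~ true_star (Imp (Ex x (Atom x)) (Ex x (Neg (Neg (Atom x)))))).
Proof.
split; last split; last split.
(* Of the resulting propositional goals only that of A3 is not intuitionistic. *)
- move=> _ [phi psi|phi psi chi|phi psi|x phi|x phi psi _];
    rewrite true_star_sem !(sem_Imp, sem_Neg_u, sem_All_u) //; tauto.
- by move=> phi psi; rewrite !true_star_sem sem_Imp.
- by move=> x phi; rewrite !true_star_sem sem_All_u.
- move=> x; rewrite true_star_sem sem_Imp => imp.
  have [|b [_ nnP]] := imp; first by exists v; rewrite /= /update eqxx.
  (* Whatever [b] is, the outer negation evaluates [Neg (Atom x)] at the constant [u], where it
     holds. *)
  by apply: nnP; split.
Qed.
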